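(* Let $X$ be a locally compact Hausdorff space and $\overline{X}$ a compactification of $X$. Let $(X,\mathcal{B},\mathbf{b})$ be the coarse proximity structure on $X$ induced by the compactification $\overline{X}$, i.e., $\mathcal{B}$ is the collection of all subsets of $X$ whose closures in $X$ are compact, and $\mathbf{b}$ is defined by $$A\mathbf{b}B\iff cl_{\overline{X}}(A)\cap cl_{\overline{X}}(B)\cap(\overline{X}\setminus X)\neq\emptyset.$$ If $\overline{X}\setminus X$ is a $Z$-set in $\overline{X}$, then $\mathcal{U}X$ (identified with $\overline{X}\setminus X$) is completely traceable.
   Context: A closed subset $A$ of a topological space $T$ is a $Z$-set in $T$ if there is a homotopy $H:T\times[0,1]\to T$ with $H(\cdot,0)=id_T$ and $H(T,t)\subseteq T\setminus A$ for all $t\in(0,1]$. The triple $(X,\mathcal{B},\mathbf{b})$ is a coarse proximity space; members of $\mathcal{B}$ are called bounded, other subsets of $X$ unbounded. Its boundary $\mathcal{U}X$ is defined as follows. The discrete extension of $\mathbf{b}$ is the separated proximity $\delta$ on $X$ given by $A\delta B\iff(A\cap B\neq\emptyset$ or $A\mathbf{b}B)$. A cluster of $(X,\delta)$ is a collection $\sigma$ of nonempty subsets of $X$ such that $A\delta B$ for all $A,B\in\sigma$; if $C\delta A$ for all $A\in\sigma$ then $C\in\sigma$; and if $A\cup B\in\sigma$ then $A\in\sigma$ or $B\in\sigma$. The Smirnov compactification $\mathfrak{X}$ is the set of all clusters with the separated proximity $\delta^*$: $\mathcal{A}\delta^*\mathcal{C}$ iff $A\delta C$ for all $A,C\subseteq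 X$ such that $A\in\sigma$ for every $\sigma\in\mathcal{A}$ and $C\in\sigma$ for every $\sigma\in\mathcal{C}$. Its topology (closure of $\mathcal{A}$ is $\{\sigma:\{\sigma\}\delta^*\mathcal{A}\}$) is compact Hausdorff; the points of $X$ are identified with the clusters containing a singleton, and $cl_{\mathfrak{X}}(A)=\{\sigma\in\mathfrak{X}:A\in\sigma\}$ for $A\subseteq X$. The boundary $\mathcal{U}X\subseteq\mathfrak{X}$ is the subspace of clusters containing no bounded set. The trace of $A\subseteq X$ is $A'=cl_{\mathfrak{X}}(A)\cap\mathcal{U}X$. For the structure induced by a compactification $\overline{X}$, $\mathcal{U}X$ is homeomorphic to (and identified with) $\overline{X}\setminus X$, with $A'$ corresponding to $cl_{\overline{X}}(A)\cap(\overline{X}\setminus X)$. A closed set $C\subseteq\mathcal{U}X$ is traceable if $A'=C$ for some unbounded $A\subseteq X$; $\mathcal{U}X$ is completely traceable if every nonempty closed $C\subseteq\mathcal{U}X$ is traceable. *)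

(* Defs.v *)
From HB Require Import structures.
From mathcomp Require Import all_boot all_order all_algebra.
From mathcomp Require Import all_classical all_reals all_analysis.

Set Implicit Arguments.
Unset Strict Implicit.
Unset Printing Implicit Defensive.

Import numFieldNormedType.Exports.
Local Open Scope classical_set_scope.
Local Open Scope ring_scope.

Record coarse_proximity (X : Type) := CoarseProximity {
  bounded : set (set X);
  cprox : set X -> set X -> Prop;
  bounded_set1 : forall x, bounded [set x];
  bounded_sub : forall A B, A `<=` B -> bounded B -> bounded A;
  bounded_setU : forall A B, bounded A -> bounded B -> bounded (A `|` B);
  cprox_sym : forall A B, cprox A B -> cprox B A;
  cprox_unbounded : forall A B, cprox A B -> ~ bounded A /\ ~ bounded B;
  unbounded_cprox : forall A B, ~ bounded (A `&` B) -> cprox A B;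
  cprox_setU : forall A B C,
    cprox (A `|` B) C <-> cprox A C \/ cprox B C;
  cprox_split : forall A B, ~ cprox A B ->
    exists E, ~ cprox A E /\ ~ cprox (~` E) B }.

Definition unbounded (X : Type) (P : coarse_proximity X) (A : set X) : Prop :=
  ~ bounded P A.

(* The discrete extension of a coarse proximity. *)
Definition dprox (X : Type) (P : coarse_proximity X) (A B : set X) : Prop :=
  A `&` B !=set0 \/ cprox P A B.

Record is_cluster (X : Type) (delta : set X -> set X -> Prop)
    (s : set (set X)) : Prop := IsCluster {
  cluster_neq0 : forall A, s A -> A !=set0;
  cluster_prox : forall A B, s A -> s B -> delta A B;
  cluster_max : forall C, (forall A, s A -> delta C A) -> s C;
  cluster_setU : forall A B, s (A `|` B) -> s A \/ s B }.

Definition smirnov (X : Type) (P : coarse_proximity X) : Type :=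
  {s : set (set X) | is_cluster (dprox P) s}.

HB.instance Definition _ (X : Type) (P : coarse_proximity X) :=
  gen_eqMixin (smirnov P).
HB.instance Definition _ (X : Type) (P : coarse_proximity X) :=
  gen_choiceMixin (smirnov P).

Definition absorbs (X : Type) (P : coarse_proximity X)
    (C : set X) (F : set (smirnov P)) : Prop :=
  forall s, F s -> sval s C.

(* The proximity of the Smirnov compactification; scl is its closure operator,
   and the topology below is the one whose closure is scl (closure_smirnov). *)
Definition sprox (X : Type) (P : coarse_proximity X)
    (F G : set (smirnov P)) : Prop :=
  forall A C, absorbs A F -> absorbs C G -> dprox P A C.

Definition scl (X : Type) (P : coarse_proximity X) (F : set (smirnov P)) :
  set (smirnov P) := [set s | sprox [set s] F].

Lemma dproxS (X : Type) (P : coarse_proximity X) (A B C : set X) :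
  A `<=` B -> dprox P A C -> dprox P B C.
Proof.
move=> AB [[x [Ax Cx]]|AC]; first by left; exists x; split=> //; exact: AB.
by right; move/setUidPr: AB => <-; apply/cprox_setU; left.
Qed.

Lemma dprox_sym (X : Type) (P : coarse_proximity X) (A B : set X) :
  dprox P A B -> dprox P B A.
Proof. by case=> [?|/cprox_sym]; [left; rewrite setIC|right]. Qed.

Lemma clusterS (X : Type) (P : coarse_proximity X) (s : smirnov P) A B :
  A `<=` B -> sval s A -> sval s B.
Proof.
move=> AB sA; apply: (cluster_max (proj2_sig s)) => C sC; apply: dproxS AB _.
exact: (cluster_prox (proj2_sig s)).
Qed.

Lemma sclP (X : Type) (P : coarse_proximity X) (F : set (smirnov P)) s :
  scl F s <-> forall C, absorbs C F -> sval s C.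
Proof.
split=> [sF C CF|h A C As CF].
  by apply: (cluster_max (proj2_sig s)) => A sA; apply/dprox_sym/sF => // _ ->.
exact: (cluster_prox (proj2_sig s) (As s erefl) (h C CF)).
Qed.

Lemma sclS (X : Type) (P : coarse_proximity X) (F G : set (smirnov P)) :
  F `<=` G -> scl F `<=` scl G.
Proof. by move=> FG s /sclP sF; apply/sclP => C CG; apply: sF => t /FG/CG. Qed.

Lemma sub_scl (X : Type) (P : coarse_proximity X) (F : set (smirnov P)) :
  F `<=` scl F.
Proof. by move=> s Fs; apply/sclP => C; apply. Qed.

Lemma scl0 (X : Type) (P : coarse_proximity X) : scl (set0 : set (smirnov P)) = set0.
Proof.
rewrite -subset0 => s /sclP/(_ set0) s0.
have /(cluster_neq0 (proj2_sig s)) : sval s set0 by exact: s0.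
by case.
Qed.

Lemma sclU (X : Type) (P : coarse_proximity X) (F G : set (smirnov P)) :
  scl (F `|` G) `<=` scl F `|` scl G.
Proof.
move=> s /sclP sFG; apply: contrapT => /not_orP[].
move=> /sclP/existsNP[C /not_implyP[CF sC]].
move=> /sclP/existsNP[D /not_implyP[DG sD]].
have : sval s (C `|` D).
  apply: sFG => t [/CF|/DG]; apply: clusterS;
    [exact: subsetUl | exact: subsetUr].
by case/(cluster_setU (proj2_sig s)).
Qed.

Lemma sclK (X : Type) (P : coarse_proximity X) (F : set (smirnov P)) :
  scl (scl F) = scl F.
Proof.
apply/seteqP; split; last exact: sub_scl.
by move=> s /sclP sF; apply/sclP => C CF; apply: sF => t /sclP; apply.
Qed.

Definition smirnov_open (X : Type) (P : coarse_proximity X) :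
  set (set (smirnov P)) := [set U | scl (~` U) `<=` ~` U].

Lemma smirnov_openT (X : Type) (P : coarse_proximity X) :
  smirnov_open [set: smirnov P].
Proof. by rewrite /smirnov_open /= setCT scl0. Qed.

Lemma smirnov_openI (X : Type) (P : coarse_proximity X) :
  setI_closed (@smirnov_open X P).
Proof.
rewrite /smirnov_open => U V /= oU oV; rewrite setCI => s /sclU[/oU|/oV];
  by [left|right].
Qed.

Lemma smirnov_open_bigU (X : Type) (P : coarse_proximity X) (I : Type)
    (f : I -> set (smirnov P)) :
  (forall i, smirnov_open (f i)) -> smirnov_open (\bigcup_i f i).
Proof.
rewrite /smirnov_open /= => of_ s sf [i _]; apply: (of_ i).
by apply: sclS sf => t; apply: contra_not => fit; exists i.
Qed.

HB.instance Definition _ (X : Type) (P : coarse_proximity X) :=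
  isOpenTopological.Build (smirnov P) (@smirnov_openT X P) (@smirnov_openI X P)
    (@smirnov_open_bigU X P).

Lemma closure_smirnov (X : Type) (P : coarse_proximity X)
    (F : set (smirnov P)) : closure F = [set s | sprox [set s] F].
Proof.
have closedE (G : set (smirnov P)) : closed G <-> scl G `<=` G.
  by rewrite -openC {1}/open /= /smirnov_open /= setCK.
rewrite -/(scl F); apply/seteqP; split.
  rewrite closureE; apply: smallest_sub; last exact: sub_scl.
  by apply/closedE; rewrite sclK.
have /closedE := @closed_closure _ F; apply: subset_trans.
by apply: sclS; exact: subset_closure.
Qed.

(* A point of X is identified with the clusters containing its singleton
   (there is exactly one such cluster, see point_cluster). *)
Definition smirnov_points (X : Type) (P : coarse_proximity X) (A : set X) :
  set (smirnov P) := [set s | exists2 x, A x & sval s [set x]].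
Arguments smirnov_points {X} P A _.

Lemma dprox1 (X : Type) (P : coarse_proximity X) x (A : set X) :
  dprox P A [set x] <-> A x.
Proof.
split=> [[[y [Ay <-]]//|/cprox_unbounded[_ []]]|Ax]; first exact: bounded_set1.
by left; exists x.
Qed.

Lemma point_cluster (X : Type) (P : coarse_proximity X) (x : X)
    (s : set (set X)) :
  is_cluster (dprox P) s /\ s [set x] <-> s = [set A | A x].
Proof.
split=> [[cs sx]|->].
  apply/seteqP; split=> A; first by move=> sA; apply/(dprox1 P); exact: (cluster_prox cs).
  move=> Ax; apply: (cluster_max cs) => B sB; apply: (@dproxS _ P [set x]).
    by move=> _ ->.
  exact: (cluster_prox cs).
split=> //; split => [A Ax|A B Ax Bx|C /(_ [set x] erefl)/(dprox1 P)//|A B []].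
- by exists x.
- by left; exists x.
- by left.
- by right.
Qed.

Lemma closure_smirnov_points (X : Type) (P : coarse_proximity X) (A : set X) :
  closure (smirnov_points P A) = [set s | sval s A].
Proof.
rewrite closure_smirnov -/(scl _); apply/seteqP; split=> s /=.
  move=> /sclP; apply => t [x Ax]; apply: clusterS.
  by move=> _ ->.
move=> sA; apply/sclP => C CA; apply: clusterS sA => x Ax.
have [cx x1] := (point_cluster P x _).2 erefl.
by apply: (CA (exist _ [set B | B x] cx)); exists x.
Qed.

Definition boundary (X : Type) (P : coarse_proximity X) : set (smirnov P) :=
  [set s | forall A, sval s A -> ~ bounded P A].
Arguments boundary {X} P _.

Definition trace (X : Type) (P : coarse_proximity X) (A : set X) :
  set (smirnov P) := closure (smirnov_points P A) `&` boundary P.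
Arguments trace {X} P A _.

Definition traceable (X : Type) (P : coarse_proximity X)
    (C : set (smirnov P)) : Prop :=
  exists2 A : set X, unbounded P A & trace P A = C.

Definition completely_traceable (X : Type) (P : coarse_proximity X) : Prop :=
  forall C : set (smirnov P), C `<=` boundary P ->
    closed (C : set (subspace (boundary P))) -> C !=set0 -> traceable C.

(* Only the values of H on T x [0, 1] are meaningful. *)
Definition Z_set (R : realType) (T : topologicalType) (A : set T) : Prop :=
  closed A /\ exists H : T * R -> T,
    [/\ {within [set: T] `*` `[0, 1], continuous H},
        forall x, H (x, 0) = x &
        forall x t, t \in `]0, 1] -> ~ A (H (x, t))].

(* The space X need not be a subset of Y: i is a dense embedding, and the
   remainder of X in Y is the complement of range i. *)
Record compactification (X Y : topologicalType) (i : X -> Y) : Prop :=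
  Compactification {
    compactification_compact : compact [set: Y];
    compactification_hausdorff : hausdorff_space Y;
    compactification_inj : injective i;
    compactification_open : forall U : set X,
      open U <-> exists2 V : set Y, open V & i @^-1` V = U;
    compactification_dense : dense (range i) }.

Definition induced_bounded (X : topologicalType) : set (set X) :=
  [set A | compact (closure A)].
Arguments induced_bounded : clear implicits.

Definition induced_cprox (X Y : topologicalType) (i : X -> Y) (A B : set X) :
  Prop := closure (i @` A) `&` closure (i @` B) `&` ~` range i !=set0.

Lemma compactification_continuous (X Y : topologicalType) (i : X -> Y) :
  compactification i -> continuous i.
Proof.
move=> ci; apply/continuousP => V oV.
by apply/(compactification_open ci); exists V.
Qed.

Lemma compactification_range_open (X Y : topologicalType) (i : X -> Y) :
  compactification i -> locally_compact [set: X] -> open (range i).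
Proof.
move=> ci lcX; rewrite openE => _ [x _ <-].
have [K nK [cK _]] := lcX x I.
rewrite /within /= in nK.
have : nbhs x K by apply: filterS nK => z /= /(_ I).
rewrite nbhsE => -[U [oU Ux] UK].
have [V oV VU] := (compactification_open ci U).1 oU.
have iKc : closed (i @` K).
  apply: compact_closed; first exact: compactification_hausdorff ci.
  apply: continuous_compact => //; apply: continuous_subspaceT.
  exact: compactification_continuous ci.
rewrite /interior nbhsE; exists V; first by split=> //; rewrite -VU in Ux.
move=> y Vy; suff [z _ <-] : (i @` K) y by exists z.
apply: iKc => W; rewrite nbhsE => -[W' [oW' W'y] W'W].
have [|u [[Vu W'u] [z _ zE]]] :=
  compactification_dense ci (O := V `&` W') _ (openI oV oW').
  by exists y.
exists u; split; last exact: W'W.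
by exists z => //; apply: UK; rewrite -VU /= zE.
Qed.

Lemma compactification_compact_preimage (X Y : topologicalType) (i : X -> Y)
    (K : set Y) :
  compactification i -> compact K -> K `<=` range i -> compact (i @^-1` K).
Proof.
move=> ci cK Ki F PF FK.
have [_ [/[dup] /Ki[x _ <-] Kx clx]] := cK (i @ F) _ FK.
exists x; split=> // A B FA; rewrite nbhsE => -[U [oU Ux] UB].
have [V oV VU] := (compactification_open ci U).1 oU.
have [||_ [[z Az <-] Vz]] := clx (i @` A) V.
- by apply: (@filterS _ F _ A) FA => z Az; exists z.
- by apply: open_nbhs_nbhs; split=> //; rewrite -VU in Ux.
- by exists z; split=> //; apply: UB; rewrite -VU.
Qed.

Lemma induced_bounded_set1 (X : topologicalType) :
  hausdorff_space X -> forall x : X, induced_bounded X [set x].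
Proof.
move=> hX x; rewrite /induced_bounded /=.
have /closure_id <- : closed [set x]; last exact: compact_set1.
exact: (accessible_closed_set1 (hausdorff_accessible hX)).
Qed.

Lemma induced_bounded_sub (X : topologicalType) (A B : set X) :
  A `<=` B -> induced_bounded X B -> induced_bounded X A.
Proof.
move=> /closureS AB cB; apply: subclosed_compact cB AB; exact: closed_closure.
Qed.

Lemma induced_bounded_setU (X : topologicalType) (A B : set X) :
  induced_bounded X A -> induced_bounded X B -> induced_bounded X (A `|` B).
Proof. by rewrite /induced_bounded /= closureU; exact: compactU. Qed.

Lemma induced_cprox_sym (X Y : topologicalType) (i : X -> Y) (A B : set X) :
  induced_cprox i A B -> induced_cprox i B A.
Proof. by rewrite /induced_cprox (setIC (closure (i @` A))). Qed.

Lemma induced_cprox_unbounded (X Y : topologicalType) (i : X -> Y) :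
  compactification i -> forall A B : set X, induced_cprox i A B ->
  ~ induced_bounded X A /\ ~ induced_bounded X B.
Proof.
move=> ci.
suff h A B : induced_cprox i A B -> ~ induced_bounded X A.
  by move=> A B AB; split; [exact: h AB|exact: h (induced_cprox_sym AB)].
move=> [y [[Ay _] ny]] cA; apply: ny.
have iAc : closed (i @` closure A).
  apply: compact_closed; first exact: compactification_hausdorff ci.
  apply: continuous_compact => //; apply: continuous_subspaceT.
  exact: compactification_continuous ci.
suff [z _ <-] : (i @` closure A) y by exists z.
apply: iAc; apply: closureS Ay; exact/image_subset/subset_closure.
Qed.

Lemma induced_unbounded_cprox (X Y : topologicalType) (i : X -> Y) :
  compactification i -> forall A B : set X,
  ~ induced_bounded X (A `&` B) -> induced_cprox i A B.
Proof.
move=> ci A B; apply: contra_notP => nAB.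
set K := closure (i @` (A `&` B)).
have Ki : K `<=` range i.
  move=> y Ky; apply: contrapT => ny; apply: nAB; exists y; split=> //.
  by split; apply: closureS Ky; apply: image_subset => ? [].
have cK : compact K.
  apply: subclosed_compact (compactification_compact ci) _ => //.
  exact: closed_closure.
apply: subclosed_compact (compactification_compact_preimage ci cK Ki) _.
  exact: closed_closure.
rewrite closureE; apply: smallest_sub.
  apply: preimage_closed; last exact: closed_closure.
  by move=> x _; exact: compactification_continuous ci x.
by move=> x ABx; apply: subset_closure; exists x.
Qed.

Lemma induced_cprox_setU (X Y : topologicalType) (i : X -> Y)
    (A B C : set X) :
  induced_cprox i (A `|` B) C <-> induced_cprox i A C \/ induced_cprox i B C.
Proof.
rewrite /induced_cprox image_setU closureU; split.
  by move=> [y [[[Ay|By] Cy] ny]]; [left|right]; exists y.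
by move=> [|] [y [[Ay Cy] ny]]; exists y; split=> //; split=> //; [left|right].
Qed.

Lemma induced_cprox_split (X Y : topologicalType) (i : X -> Y) :
  compactification i -> locally_compact [set: X] -> forall A B : set X,
  ~ induced_cprox i A B ->
  exists E, ~ induced_cprox i A E /\ ~ induced_cprox i (~` E) B.
Proof.
move=> ci lcX A B nAB.
have clN : closed (~` range i).
  exact: open_closedC (compactification_range_open ci lcX).
pose PA := closure (i @` A) `&` ~` range i.
pose QB := closure (i @` B) `&` ~` range i.
have cP : closed PA by apply: closedI => //; exact: closed_closure.
have cQ : closed QB by apply: closedI => //; exact: closed_closure.
have nor := compact_normal (compactification_hausdorff ci)
  (compactification_compact ci).
have nQ : set_nbhs PA (~` QB).
  apply/set_nbhsP; exists (~` QB); split=> //; first exact: closed_openC.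
  by move=> y [Ay ny] [By _]; apply: nAB; exists y.
have [W nW cW] := nor PA cP _ nQ.
have [U [oU PU UW]] := (set_nbhsP _ _).1 nW.
exists (i @^-1` (~` closure W)); split.
  move=> [y [[Ay Ey] ny]].
  have [z [[x Wx <-] Ux]] : (i @` (i @^-1` (~` closure W)) `&` U) !=set0.
    by apply: Ey; apply: open_nbhs_nbhs; split=> //; apply: PU; split.
  by apply: Wx; apply: subset_closure; exact: UW.
move=> [y [[Ey By] ny]]; suff /cW : closure W y by apply; split.
move: Ey; rewrite closureE; apply; split; first exact: closed_closure.
by move=> _ [x /= /contrapT Wx <-].
Qed.

Definition induced_coarse_proximity (X Y : topologicalType) (i : X -> Y)
    (lcX : locally_compact [set: X]) (hX : hausdorff_space X)
    (ci : compactification i) : coarse_proximity X :=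
  CoarseProximity (induced_bounded_set1 hX) (@induced_bounded_sub X)
    (@induced_bounded_setU X) (@induced_cprox_sym X Y i)
    (induced_cprox_unbounded ci) (induced_unbounded_cprox ci)
    (@induced_cprox_setU X Y i) (induced_cprox_split ci lcX).

(* Main.v *)
Require Import Defs.
From mathcomp Require Import all_boot all_order all_algebra.
From mathcomp Require Import all_classical all_reals all_analysis.

Import Order.TTheory Num.Theory.
Local Open Scope classical_set_scope.

(** Write N for the remainder of X in its compactification, and H for the
    homotopy that pushes N instantly into X.

    A compact subset K of N is the part in N of the closure of a subset of X,
    namely of the track H(K x ]0, 1]).  Indeed the track lies in the compact,
    hence closed, set H(K x [0, 1]), whose only points in N are those at time 0,
    that is, the points of K; and each point k of K is the limit of H(k, t) as t
    tends to 0 (Z_set_closure_trace).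

    It remains to carry this over to clusters.  Each point z of N gives the
    cluster of the sets A whose image is adherent to z, which contains no
    bounded set (adherence_cluster, adherence_unbounded), and every cluster of
    the boundary arises so (boundary_adherence).  Thus a closed set C of boundary
    clusters becomes a set K of points of N, closed because membership in the
    closure of C is tested on the sets A absorbing C, for which K lies in the
    closure of the image of A.  The trace of A consists of the clusters of the
    points of N adherent to A, so the track of K, pulled back to X, has trace C;
    it is unbounded because C is nonempty. *)

(** The witness is the track of K under the homotopy, without its initial
    position; adding time 0 makes it closed and adds only the points of K. *)
Lemma Z_set_closure_trace (R : realType) (T : topologicalType) (N K : set T) :
  hausdorff_space T -> Z_set R N -> compact K -> K `<=` N ->
  exists2 A, A `<=` ~` N & closure A `&` N = K.
Proof.
move=> hT [_ [H [cH H0 HN]]] cK KN.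
exists (H @` (K `*` `]0%R, 1%R])) => [_ [[k t] [/= _ t01] <-]|]; first exact: HN.
apply/seteqP; split=> [y [Ay Ny]|k Kk].
  have tubeC : closed (H @` (K `*` `[0%R, 1%R])).
    apply: compact_closed => //; apply: continuous_compact.
      by apply: continuous_subspaceW cH => -[k t] [].
    by apply: compact_setX => //; exact: segment_compact.
  have [[k t] [/= Kk t01] Hkt] : (H @` (K `*` `[0%R, 1%R])) y.
    apply: tubeC; apply: closureS Ay; apply: image_subset.
    by move=> [k t] [/= Kk t01]; split=> //; exact: subset_itv_oc_cc t01.
  have [t0|t0] := eqVneq t 0%R; first by rewrite -Hkt t0 H0.
  exfalso; apply: (HN k t); last by rewrite Hkt.
  by move: t01; rewrite /= !in_itv /= lt_neqAle eq_sym t0.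
split; last exact: KN.
move=> V Vk; have k0 : ([set: T] `*` `[0%R : R, 1%R]) (k, 0%R).
  by split=> //=; rewrite in_itv /= lexx ler01.
have HVk : nbhs (H (k, 0%R)) V by rewrite H0.
have [[B1 B2] /= [B1k B20] BV] :=
  (subspace_continuousP _ _).1 cH (k, 0%R) k0 V HVk.
have [t [[B2t t0] t1]] : exists t : R, (B2 t /\ (0 < t)%R) /\ (t <= 1)%R.
  have : \forall t \near (0%R : R)^'+, (B2 t /\ (0 < t)%R) /\ (t <= 1)%R.
    near=> t; split; last by near: t; exact: nbhs_right_le.
    split; last by near: t; exact: nbhs_right_gt.
    by near: t; exact: cvg_within.
  by move/filter_ex.
exists (H (k, t)); split.
  by exists (k, t) => //; split=> //=; rewrite in_itv /= t0.
apply: (BV (k, t)); first by split=> //=; exact: nbhs_singleton.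
by split=> //=; rewrite in_itv /= (ltW t0).
Unshelve. all: by end_near. Qed.

Lemma compactification_adherent_preimage (X Y : topologicalType) (i : X -> Y)
    (y : Y) (V : set Y) :
  compactification i -> nbhs y V -> closure (i @` (i @^-1` V)) y.
Proof.
move=> ci Vy W Wy.
have : nbhs y (V `&` W) by exact: filterI.
rewrite nbhsE => -[U [oU Uy] UVW].
have [||u [Uu [x _ xu]]] := compactification_dense ci (O := U) => //.
  by exists y.
have [Vu Wu] := UVW _ Uu.
by exists u; split=> //; exists x => //; rewrite /preimage /= xu.
Qed.

(** Regularity of the compactification, expressed through the proximity: a
    closed neighbourhood of the point missing the closure of the image does. *)
Lemma far_nbhs_preimage (X Y : topologicalType) (i : X -> Y)
    (lcX : locally_compact [set: X]) (hX : hausdorff_space X)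
    (ci : compactification i) (y : Y) (A : set X) :
  ~ closure (i @` A) y ->
  exists2 V, nbhs y V &
    ~ dprox (induced_coarse_proximity lcX hX ci) (i @^-1` V) A.
Proof.
move=> nAy.
have [|V Vy VA] := compact_regular (compactification_hausdorff ci)
  (compactification_compact ci) (x := y) filterT (t := ~` closure (i @` A)).
  by apply: open_nbhs_nbhs; split=> //; apply: closed_openC; exact: closed_closure.
exists V => // -[[x [Vx Ax]]|[z [[Vz Az] _]]].
  by apply: (VA (i x)); apply: subset_closure => //; exists x.
apply: (VA z) => //; apply: closureS Vz; exact: image_preimage_subset.
Qed.

Definition adherence (X Y : topologicalType) (i : X -> Y) (y : Y) :
  set (set X) := [set A | closure (i @` A) y].
Arguments adherence {X Y} i y _.

(** Maximality is the substantial axiom: if z is not adherent to C, then some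
    neighbourhood of z has a preimage far from C, and z is adherent to that
    preimage by density. Two members are close because their closures share
    z, a point of the remainder. *)
Lemma adherence_cluster (X Y : topologicalType) (i : X -> Y)
    (lcX : locally_compact [set: X]) (hX : hausdorff_space X)
    (ci : compactification i) (z : Y) :
  ~ range i z ->
  is_cluster (dprox (induced_coarse_proximity lcX hX ci)) (adherence i z).
Proof.
move=> Nz; split=> [A Az|A B Az Bz|C Cz|A B].
- by have [_ [[x Ax _] _]] := Az setT filterT; exists x.
- by right; exists z.
- apply: contrapT => /(far_nbhs_preimage _ _ i lcX hX ci)[V Vz]; apply.
  by apply/dprox_sym/Cz; exact: compactification_adherent_preimage.
- by rewrite /adherence /= image_setU closureU.
Qed.

(** The point z witnesses that A is close to itself in the coarse proximity,
    which relates only unbounded sets. *)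
Lemma adherence_unbounded (X Y : topologicalType) (i : X -> Y)
    (lcX : locally_compact [set: X]) (hX : hausdorff_space X)
    (ci : compactification i) (z : Y) (A : set X) :
  ~ range i z -> adherence i z A ->
  unbounded (induced_coarse_proximity lcX hX ci) A.
Proof.
move=> Nz Az.
have /cprox_unbounded[] // : cprox (induced_coarse_proximity lcX hX ci) A A.
by exists z.
Qed.

(** The complements of the sets outside a cluster form a proper filter, because
    a cluster is a grill.  By compactness its image has a cluster point y.  The
    preimages of the neighbourhoods of y belong to the cluster; hence y is
    adherent to every member, by regularity, and y is not in the range when all
    members are unbounded, by local compactness.  Maximality of the cluster
    gives the equality. *)
Lemma boundary_adherence (X Y : topologicalType) (i : X -> Y)
    (lcX : locally_compact [set: X]) (hX : hausdorff_space X)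
    (ci : compactification i)
    (s : smirnov (induced_coarse_proximity lcX hX ci)) :
  boundary _ s -> exists2 z, ~ range i z & sval s = adherence i z.
Proof.
move=> bs; have cs := proj2_sig s.
pose F : set_system X := [set B | ~ sval s (~` B)].
have FF : ProperFilter F.
  split; rewrite /F /=.
    rewrite setC0; apply; apply: (cluster_max cs) => A sA; left.
    by rewrite setTI; exact: (cluster_neq0 cs).
  split=> [|A B FA FB|A B AB]; rewrite /= ?setCT.
  - by move/(cluster_neq0 cs) => -[].
  - by rewrite setCI => /(cluster_setU cs)[].
  - by apply: contra_not; apply: clusterS; exact: subsetC.
have [y [_ Fy]] := compactification_compact ci (fmap_proper_filter i FF) filterT.
have sy V : nbhs y V -> sval s (i @^-1` V).
  move=> Vy; apply: contrapT => nsV.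
  have [||_ [[x nVx <-] Vx]] := Fy (i @` ~` (i @^-1` V)) V => //.
  apply: (@filterS _ F _ (~` (i @^-1` V))); first by move=> x nVx; exists x.
  by rewrite /F /= setCK.
have ys A : sval s A -> closure (i @` A) y.
  move=> sA; apply: contrapT => /(far_nbhs_preimage _ _ i lcX hX ci)[V Vy]; apply.
  by apply: (cluster_prox cs) => //; exact: sy.
have Ny : ~ range i y.
  move=> Xy; have oX := compactification_range_open ci lcX.
  have [|V Vy VX] := compact_regular (compactification_hausdorff ci)
    (compactification_compact ci) (x := y) filterT (t := range i).
    by apply: open_nbhs_nbhs; split.
  apply: (bs _ (sy V Vy)); rewrite /= /induced_bounded /=.
  have cV : compact (i @^-1` closure V).
    apply: compactification_compact_preimage => //.
    apply: subclosed_compact (compactification_compact ci) _ => //.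
    exact: closed_closure.
  apply: subclosed_compact cV _; first exact: closed_closure.
  rewrite closureE; apply: smallest_sub.
    apply: preimage_closed; last exact: closed_closure.
    by move=> x _; exact: compactification_continuous ci x.
  by apply: preimage_subset; exact: subset_closure.
exists y => //; apply/seteqP; split=> A; first exact: ys.
move=> Ay; apply: (cluster_max cs) => B /ys By.
by right; exists y.
Qed.

Theorem theorem4p4 (R : realType) (X Xbar : topologicalType) (i : X -> Xbar)
    (lcX : locally_compact [set: X]) (hX : hausdorff_space X)
    (ci : compactification i) :
  Z_set R (~` range i) ->
  completely_traceable (induced_coarse_proximity lcX hX ci).
Proof.
move=> ZN C Cb /closed_subspaceP[D cD DC] [s0 Cs0].
have cN : closed (~` range i) by case: ZN.
pose K := [set z | ~ range i z /\
  exists2 s, C s & sval s = adherence i z].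
have cK : closed K.
  move=> z clz.
  have Nz : ~ range i z by apply: cN; apply: closureS clz => ? [].
  pose s : smirnov (induced_coarse_proximity lcX hX ci) :=
    exist _ _ (adherence_cluster _ _ i lcX hX ci z Nz).
  have bs : boundary _ s by move=> A; exact: adherence_unbounded.
  split=> //; exists s => //.
  (* The clusters of the points of K lie in C, so the image of a set absorbing C
     has K, and with it z, in its closure. *)
  have sC : closure C s.
    rewrite closure_smirnov; apply/sclP => A AC.
    rewrite /= /adherence /=; move: clz; rewrite [X in _ -> X z](closure_id _).1.
      by apply: closureS => k [_ [t Ct tk]]; have := AC t Ct; rewrite tk.
    exact: closed_closure.
  (* C is closed in the boundary only: D is a closed set of clusters that cuts
     out C there. *)
  suff : (C `&` boundary _) s by case.
  rewrite -DC; split=> //; apply: cD; apply: closureS sC => t Ct.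
  suff : (D `&` boundary _) t by case.
  by rewrite DC; split=> //; exact: Cb.
have [||A0 A0N A0K] := Z_set_closure_trace R _ _ K
    (compactification_hausdorff ci) ZN.
- exact: subclosed_compact cK (compactification_compact ci) _.
- by move=> z [].
pose A := i @^-1` A0.
have iA : i @` A = A0.
  apply/seteqP; split; first exact: image_preimage_subset.
  by move=> y A0y; have /contrapT[x _ xy] := A0N _ A0y; exists x => //; rewrite /A /= xy.
have AK z : ~ range i z -> adherence i z A <-> K z.
  by move=> Nz; rewrite /adherence /= iA -A0K; split=> [|[]].
exists A.
  have [z Nz s0z] := boundary_adherence _ _ i lcX hX ci _ (Cb _ Cs0).
  apply: (adherence_unbounded _ _ i lcX hX ci z) => //.
  by apply/(AK z Nz); split=> //; exists s0.
rewrite /trace closure_smirnov_points; apply/seteqP; split=> s /=.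
  move=> [sA bs]; have [z Nz sz] := boundary_adherence _ _ i lcX hX ci _ bs.
  move: sA; rewrite sz => /(AK z Nz)[_ [t Ct tz]].
  suff -> : s = t by [].
  apply: eq_sig_hprop; last by rewrite sz tz.
  by move=> ? ? ?; exact: Prop_irrelevance.
move=> Cs; split; last exact: Cb.
have [z Nz sz] := boundary_adherence _ _ i lcX hX ci _ (Cb _ Cs).
by rewrite sz; apply/(AK z Nz); split=> //; exists s.
Qed.
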